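(* Let $Y$ be a random variable whose moment generating function $E[e^{tY}]$ exists for $|t|<r_0$ for some $r_0>0$. Let $(Y_j)_{j\ge1}$ be mutually independent copies of $Y$, $S_0=0$, $S_k=Y_1+\cdots+Y_k$ for $k\ge1$. Define $\phi_n^Y(x,y)$ by $$\Big(1+y\big(E[e^{Yt}]-1\big)\Big)^{x}=\sum_{n=0}^{\infty}\phi_n^Y(x,y)\frac{t^n}{n!}.$$ Then for all integers $m,n\ge 0$, $$\phi_{m+n}^Y(x,y)=\sum_{k=0}^{n}\sum_{j=0}^{m}\binom{m}{j}\phi_j^Y(x-k,y)(x)_k y^k\frac{1}{k!}\sum_{l_1+\cdots+l_k=n}\binom{n}{l_1,\dots,l_k}E\Big[S_k^{m-j}\prod_{i=1}^{k}Y_i^{l_i}\Big],$$ where the inner sum runs over $k$-tuples $(l_1,\dots,l_k)$ of positive integers with sum $n$.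
   Context: $(x)_0=1$, $(x)_k=x(x-1)\cdots(x-k+1)$ for $k\ge1$. The power $(1+u)^x$ is understood via the binomial series $\sum_{k\ge0}\binom{x}{k}u^k$ and the defining identity is one of power series in $t$; $x,y$ are variables. For $k=0$ the sum over $(l_1,\dots,l_k)$ is the empty-composition sum, equal to $1$ if $n=0$ and $0$ otherwise (empty product equal to $1$). $\binom{n}{l_1,\dots,l_k}$ is the multinomial coefficient. *)

(* Defs.v *)
From HB Require Import structures.
From mathcomp Require Import all_boot all_order all_algebra.
From mathcomp Require Import all_classical all_reals all_analysis.
Set Implicit Arguments. Unset Strict Implicit. Unset Printing Implicit Defensive.
Import Order.TTheory GRing.Theory Num.Theory.
Local Open Scope classical_set_scope.
Local Open Scope ring_scope.

(* A formal power series is its coefficient sequence a : nat -> R,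
   a n = coefficient of t^n. *)
Definition ps1 (R : realType) : nat -> R := fun n => (n == 0%N)%:R.
Definition psmul (R : realType) (a b : nat -> R) : nat -> R :=
  fun n => \sum_(i < n.+1) a i * b (n - i)%N.
Definition pspow (R : realType) (a : nat -> R) (k : nat) : nat -> R :=
  iter k (psmul a) (ps1 R).

Definition falling (R : realType) (x : R) (k : nat) : R :=
  \prod_(i < k) (x - i%:R).

(* binomial series (1+u)^x = sum_k binom(x,k) u^k, for a formal power series u
   with zero constant term (then only k <= n contribute to the coefficient of t^n) *)
Definition psbinom (R : realType) (x : R) (u : nat -> R) : nat -> R :=
  fun n => \sum_(k < n.+1) (falling x k / k`!%:R) * pspow u k n.

Definition Ereal (R : realType) (d : measure_display) (T : measurableType d)
  (P : probability T R) (f : T -> R) : R :=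
  fine (\int[P]_w (f w)%:E)%E.

Definition mutually_independent (R : realType) (d : measure_display)
  (T : measurableType d) (P : probability T R) (X : nat -> T -> R) : Prop :=
  forall (J : seq nat) (A : nat -> set R), uniq J ->
    (forall i, measurable (A i)) ->
    P (\big[setI/setT]_(i <- J) (X i @^-1` A i)) =
    (\prod_(i <- J) P (X i @^-1` A i))%E.

Definition same_law (R : realType) (d : measure_display) (T : measurableType d)
  (P : probability T R) (X : T -> R) (d' : measure_display)
  (U : measurableType d') (Q : probability U R) (Y : U -> R) : Prop :=
  forall A : set R, measurable A -> P (X @^-1` A) = Q (Y @^-1` A).

(* E[e^{tY}] as a formal power series in t: coefficients E[Y^n]/n! *)
Definition mgf_ps (R : realType) (d : measure_display) (T : measurableType d)
  (P : probability T R) (Y : T -> R) : nat -> R :=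
  fun n => Ereal P (fun w => Y w ^+ n) / n`!%:R.

Definition phiY (R : realType) (d : measure_display) (T : measurableType d)
  (P : probability T R) (Y : T -> R) (n : nat) (x y : R) : R :=
  n`!%:R * psbinom x (fun j => y * (mgf_ps P Y j - ps1 R j)) n.

(* partial sums S_k = Y_1 + ... + Y_k, with Y_{i+1} := Ys i *)
Definition Ssum (R : realType) (d : measure_display) (T : measurableType d)
  (Ys : nat -> T -> R) (k : nat) : T -> R :=
  fun w => \sum_(i < k) Ys i w.

Definition multinom (R : realType) (n : nat) {k : nat} (l : 'I_k -> nat) : R :=
  n`!%:R / \prod_(i < k) (l i)`!%:R.

Definition comp_sum (R : realType) (d : measure_display) (T : measurableType d)
  (P : probability T R) (Ys : nat -> T -> R) (n k p : nat) : R :=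
  \sum_(l : {ffun 'I_k -> 'I_n.+1} |
          ((\sum_(i < k) (l i : nat))%N == n) && [forall i, (0 < (l i : nat))%N])
    multinom R n (fun i => (l i : nat)) *
    Ereal P (fun w => Ssum Ys k w ^+ p * \prod_(i < k) Ys i w ^+ (l i : nat)).

(* Main.v *)
(** Write F(t) = (1 + y (M(t) - 1))^x with M(t) = E[exp(tY)], U = y (M - 1) and
V(t, s) = U(t + s) - U(t).  Expanding the binomial series of F(t + s) =
(1 + U(t) + V(t, s))^x in powers of V gives
  F(t + s) = sum_k binom(x, k) V(t, s)^k (1 + U(t))^(x - k),
and by independence V(t, s)^k = y^k E[exp(t S_k) prod_i (exp(s Y_i) - 1)].  The
theorem compares the coefficients of s^n t^m; since V vanishes at s = 0, only
k <= n contributes.  All series are truncated to polynomials in t (with s as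
the outer variable). *)

Require Import Defs.
From HB Require Import structures.
From mathcomp Require Import all_boot all_order all_algebra.
From mathcomp Require Import all_classical all_reals all_analysis.
From mathcomp Require Import measurable_realfun ring lra zify.
Set Implicit Arguments. Unset Strict Implicit. Unset Printing Implicit Defensive.
Import Order.TTheory GRing.Theory Num.Theory.
Import HBNNSimple.
Local Open Scope classical_set_scope.
Local Open Scope ring_scope.

(** * Truncated binomial series *)

Definition binr (R : realType) (x : R) (k : nat) : R := falling x k / k`!%:R.

Lemma fallingD (R : realType) (x : R) (i j : nat) :
  falling x (i + j) = falling x i * falling (x - i%:R) j.
Proof.
rewrite /falling big_split_ord /=; congr (_ * _).
by apply: eq_bigr => k _; rewrite natrD opprD addrA.
Qed.

Lemma fact_neq0 (R : realType) (k : nat) : k`!%:R != 0 :> R.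
Proof. by rewrite pnatr_eq0 -lt0n fact_gt0. Qed.

Lemma natr_bin_fact (R : realType) (i j : nat) :
  (i + j)`!%:R = 'C(i + j, i)%:R * (i`!%:R * j`!%:R) :> R.
Proof. by rewrite -!natrM -(bin_fact (leq_addr j i)) addKn. Qed.

(** Both sides equal [falling x (i + j)] over i! j!. The form without division lets the identity be
    transported along a ring morphism. *)
Lemma binrD (R : realType) (x : R) (i j : nat) :
  binr x (i + j) * 'C(i + j, i)%:R = binr x i * binr (x - i%:R) j.
Proof.
have bin_neq0 : 'C(i + j, i)%:R != 0 :> R.
  by rewrite pnatr_eq0 -lt0n bin_gt0 leq_addr.
rewrite /binr fallingD natr_bin_fact; field.
by rewrite bin_neq0 !fact_neq0.
Qed.

(** The scalars enter [A] through [f], so that one definition serves polynomials in t ([f] is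
    [polyC]) and polynomials in s over these ([f] is [polyC \o polyC]). *)
Definition binsum (R : realType) (A : comNzRingType) (f : R -> A) (N : nat)
    (x : R) (u : A) : A :=
  \sum_(k < N) f (binr x k) * u ^+ k.

(* Vandermonde's binom(x, i + j) C(i + j, i) = binom(x, i) binom(x - i, j)
   regroups the truncated binomial series by powers of v. *)
Lemma binsumD (R : realType) (A : comNzRingType) (f : {rmorphism R -> A})
    (N : nat) (x : R) (u v : A) :
  binsum f N x (u + v) =
  \sum_(i < N) f (binr x i) * v ^+ i * binsum f (N - i) (x - i%:R) u.
Proof.
pose F k i := f (binr x k) * (u ^+ (k - i) * v ^+ i *+ 'C(k, i)).
have -> : binsum f N x (u + v) =
    \sum_(0 <= k < N) \sum_(0 <= i < N | (i <= k)%N) F k i.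
  rewrite /binsum big_mkord; apply: eq_bigr => k _.
  rewrite exprDn mulr_sumr (big_ord_widen N (F k)) ?ltn_ord//.
  by rewrite big_mkord.
rewrite (exchange_big_dep_nat predT) //= big_mkord.
apply: eq_bigr => i _; rewrite /binsum mulr_sumr.
rewrite -[RHS](big_mkord predT
  (fun k => f (binr x i) * v ^+ i * (f (binr (x - i%:R) k) * u ^+ k))).
rewrite [LHS](@big_cat_nat _ _ _ i) ?ltn_ord//=; last exact: ltnW.
rewrite big_nat_cond big_pred0 ?add0r; last by move=> k; lia.
rewrite -{1}(add0n i) big_addn; apply: eq_big => [k|k _]; first by lia.
rewrite /F addnK [(k + i)%N]addnC.
transitivity (f (binr x (i + k) * 'C(i + k, i)%:R) * (u ^+ k * v ^+ i)).
  by rewrite -mulr_natr rmorphM rmorph_nat; ring.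
by rewrite binrD rmorphM; ring.
Qed.

(** * Coefficients of products, powers and shifts of polynomials *)

Lemma coef_poly_XaY (R : comNzRingType) (p : {poly R}) (i j : nat) :
  (poly_XaY p)`_i`_j = p`_(i + j) *+ 'C(i + j, i).
Proof.
(* Taylor expansion around t: the coefficient of s^i in p(t + s) is the i-th normalized derivative
   of p, whose own coefficients carry the binomials. *)
rewrite -coef_nderivn /poly_XaY /comp_poly addrC.
rewrite (nderiv_taylor_wide (mulrC _ _) (leqnn _)).
under eq_bigr do rewrite !nderivn_map horner_map /=
  -/(comp_poly _ _) comp_polyXr mul_polyC.
rewrite -(poly_def _ (fun l => p^`N(l))) coef_poly; case: ltnP => // size_p.
rewrite nderivn_poly0 //; move: size_p; rewrite !size_map_polyC //.
Qed.

Lemma coef_prod_ffun (R : comNzRingType) (k n : nat) (p : 'I_k -> {poly R}) :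
  (\prod_(i < k) p i)`_n =
  \sum_(l : {ffun 'I_k -> 'I_n.+1} | (\sum_(i < k) l i)%N == n)
     \prod_(i < k) (p i)`_(l i).
Proof.
(* Truncating each factor above degree n leaves coefficient n alone and gives all factors the same
   index range, so that the product of sums distributes over functions. The induction needs every
   degree up to n. *)
have -> : (\prod_(i < k) p i)`_n = (\prod_(i < k) take_poly n.+1 (p i))`_n.
  suff : forall m, (m <= n)%N ->
      (\prod_(i < k) p i)`_m = (\prod_(i < k) take_poly n.+1 (p i))`_m by exact.
  elim/big_ind2: _ => // [p1 p2 q1 q2 H1 H2 m mn|i _ m mn].
    rewrite !coefM; apply: eq_bigr => a _.
    by rewrite H1 ?H2//; have := ltn_ord a; lia.
  by rewrite coef_take_poly ltnS mn.
under [in LHS]eq_bigr do rewrite /take_poly poly_def.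
rewrite bigA_distr_bigA /= coef_sum [RHS]big_mkcond; apply: eq_bigr => l _.
under eq_bigr do rewrite -mul_polyC.
rewrite big_split /= -rmorph_prod coefCM -expr_sum coefXn eq_sym.
by case: eqP => _; rewrite ?mulr1 ?mulr0.
Qed.

Lemma coef_exp_small (R : comNzRingType) (p : {poly R}) (k i : nat) :
  p`_0 = 0 -> (i < k)%N -> (p ^+ k)`_i = 0.
Proof.
move=> p0; elim: k i => // k IH i ik.
rewrite exprS coefM big1 // => -[[|j] /= ji] _; first by rewrite p0 mul0r.
by rewrite IH ?mulr0 //; lia.
Qed.

(** Since p has no constant term, its powers with exponent above i do not reach degree i. Hence the
    truncation order may be changed freely above the degree that is read off. *)
Lemma coef_binsum_widen (R : realType) (x : R) (p : {poly R}) (N K i : nat) :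
  p`_0 = 0 -> (i < N)%N -> (N <= K)%N ->
  (binsum polyC K x p)`_i = (binsum polyC N x p)`_i.
Proof.
move=> p0 iN NK; rewrite /binsum !coef_sum.
rewrite [RHS](big_ord_widen K (fun k => ((binr x k)%:P * p ^+ k)`_i)) //.
rewrite [RHS]big_mkcond; apply: eq_bigr => k _ /=; case: ltnP => // Nk.
by rewrite coefCM coef_exp_small ?mulr0 //; lia.
Qed.

Lemma pspow_poly (R : realType) (u : nat -> R) (N k i : nat) :
  (i < N)%N -> pspow u k i = ((\poly_(j < N) u j) ^+ k)`_i.
Proof.
elim: k i => [|k IH] i iN; first by rewrite expr0 coef1.
rewrite exprS coefM -[LHS]/(\sum_(j < i.+1) u j * pspow u k (i - j)%N).
apply: eq_bigr => j _.
have jN : (j < N)%N by rewrite (leq_trans (ltn_ord j)).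
by rewrite coef_poly jN IH //; lia.
Qed.

(** Bridge from coefficient sequences to polynomials. The order of truncation in [psbinom] moves
    with the degree i, whereas here one [N] serves all degrees below it. *)
Lemma psbinom_poly (R : realType) (x : R) (u : nat -> R) (N i : nat) :
  u 0%N = 0 -> (i < N)%N ->
  psbinom x u i = (binsum polyC N x (\poly_(j < N) u j))`_i.
Proof.
move=> u0 iN; rewrite (@coef_binsum_widen _ _ _ i.+1) //; last first.
  by rewrite coef_poly u0 if_same.
rewrite /psbinom /binsum coef_sum; apply: eq_bigr => k _.
by rewrite coefCM (pspow_poly _ _ iN).
Qed.

(* p(s + t) - p(t), as a polynomial in s over the polynomials in t *)
Definition poly_shift (R : comNzRingType) (p : {poly R}) : {poly {poly R}} :=
  poly_XaY p - p%:P.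

Lemma coef_poly_shift (R : comNzRingType) (p : {poly R}) (i j : nat) :
  (poly_shift p)`_i`_j = if i == 0%N then 0 else p`_(i + j) *+ 'C(i + j, i).
Proof.
rewrite /poly_shift coefB coefC; case: eqP => [->|_]; last first.
  by rewrite subr0 coef_poly_XaY.
by rewrite coefB coef_poly_XaY bin0 subrr.
Qed.

Lemma poly_shift0 (R : comNzRingType) (p : {poly R}) : (poly_shift p)`_0 = 0.
Proof. by apply/polyP => j; rewrite coef_poly_shift coef0. Qed.

(** Substituting t + s for t is a ring morphism that fixes the scalars. *)
Lemma binsum_poly_XaY (R : realType) (x : R) (p : {poly R}) (N : nat) :
  poly_XaY (binsum polyC N x p) = binsum (polyC \o polyC) N x (poly_XaY p).
Proof.
rewrite /poly_XaY /binsum !rmorph_sum /=; apply: eq_bigr => k _.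
by rewrite rmorphM rmorphXn /= comp_polyM (rmorphXn (comp_poly _)) map_polyC /=
  comp_polyC.
Qed.

Lemma binsumC (R : realType) (x : R) (p : {poly R}) (N : nat) :
  binsum (polyC \o polyC) N x p%:P = (binsum polyC N x p)%:P.
Proof.
rewrite /binsum rmorph_sum; apply: eq_bigr => k _ /=.
by rewrite [RHS]polyCM polyC_exp.
Qed.

(** Coefficient of s^n t^m in the expansion of the binomial series at p(t + s) = p(t) + (p(t + s) -
    p(t)). On the left, Taylor expansion produces the factor C(m + n, n). *)
Lemma coef_binsumD (R : realType) (x : R) (p : {poly R}) (m n : nat) :
  p`_0 = 0 ->
  (binsum polyC (m + n).+1 x p)`_(m + n) * 'C(m + n, n)%:R =
  \sum_(k < n.+1) \sum_(j < m.+1) binr x k *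
     (binsum polyC (m + n).+1 (x - k%:R) p)`_j * (poly_shift p ^+ k)`_n`_(m - j).
Proof.
move=> p0.
rewrite mulr_natr addnC -coef_poly_XaY binsum_poly_XaY.
have -> : poly_XaY p = p%:P + poly_shift p by rewrite /poly_shift addrC subrK.
rewrite (binsumD (polyC \o polyC)) !coef_sum.
(* The expansion runs over all k up to m + n. The terms with k > n vanish because the shift is
   divisible by s. *)
rewrite [RHS](big_ord_widen (n + m).+1 (fun k => \sum_(j < m.+1) binr x k *
     (binsum polyC (n + m).+1 (x - k%:R) p)`_j *
     (poly_shift p ^+ k)`_n`_(m - j))); last by lia.
rewrite [RHS]big_mkcond; apply: eq_bigr => k _ /=.
rewrite binsumC coefMC coefCM.
case: ltnP => nk; last first.
  by rewrite coef_exp_small ?poly_shift0 // mulr0 mul0r coef0.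
rewrite mulrAC coefM; apply: eq_bigr => j _.
(* The expansion leaves a series truncated at order m + n + 1 - k; as k <= n and j <= m, this still
   exceeds j. *)
rewrite coefCM (@coef_binsum_widen _ _ _ ((n + m).+1 - k) (n + m).+1) //; last lia.
by have := ltn_ord j; lia.
Qed.

(* Read off the product of the truncated exponential series of the Y i. *)
Lemma sum_exp_multinomial (R : realType) (k p : nat) (Y : 'I_k -> R) :
  (\sum_(i < k) Y i) ^+ p =
  \sum_(b : {ffun 'I_k -> 'I_p.+1} | (\sum_(i < k) b i)%N == p)
     p`!%:R * \prod_(i < k) (Y i ^+ b i / (b i)`!%:R).
Proof.
pose ex (c : R) := \poly_(j < p.+1) (c ^+ j / j`!%:R).
have exD : forall q, (q < p.+1)%N ->
    (\prod_(i < k) ex (Y i))`_q = (\sum_(i < k) Y i) ^+ q / q`!%:R.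
  elim/big_ind2: _ => [q _|u a v b IHu IHv q qp|i _ q qp].
  - by rewrite coef1 expr0n; case: q => [|q]; rewrite /= ?fact0 ?divr1 ?mul0r.
  - rewrite coefM addrC exprDn mulr_suml; apply: eq_bigr => -[j /= jq] _.
    rewrite IHu ?IHv; [|lia|lia].
    have := natr_bin_fact R j (q - j); rewrite subnKC; last by lia.
    have bin_neq0 : 'C(q, j)%:R != 0 :> R by rewrite pnatr_eq0 -lt0n bin_gt0.
    by move=> ->; rewrite -mulr_natr; field; rewrite bin_neq0 !fact_neq0.
  - by rewrite coef_poly qp.
rewrite -mulr_sumr -[LHS](mulfVK (fact_neq0 R p)) -exD // coef_prod_ffun mulrC.
congr (_ * _); apply: eq_bigr => b _; apply: eq_bigr => i _.
by rewrite coef_poly ltn_ord.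
Qed.

(** Here [e] stands for the moment sequence. The k factors are expanded first in s (exponents [l]),
    then in t (exponents [b]), and C(l + b, l) / (l + b)! = 1 / (l! b!) in each factor. *)
Lemma coef_poly_shift_exp (R : realType) (e : nat -> R) (y : R)
    (N k n p : nat) : (n + p < N)%N ->
  (poly_shift (\poly_(j < N) (y * (e j / j`!%:R - ps1 R j))) ^+ k)`_n`_p =
  y ^+ k * \sum_(l : {ffun 'I_k -> 'I_n.+1} |
      ((\sum_(i < k) l i)%N == n) && [forall i, (0 < l i)%N])
    \sum_(b : {ffun 'I_k -> 'I_p.+1} | (\sum_(i < k) b i)%N == p)
      \prod_(i < k) (e (b i + l i)%N / ((b i)`!%:R * (l i)`!%:R)).
Proof.
move=> npN; set U := \poly_(j < N) _.
have -> : poly_shift U ^+ k = \prod_(i < k) poly_shift U.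
  by rewrite prodr_const card_ord.
rewrite coef_prod_ffun coef_sum mulr_sumr big_mkcondr /=.
apply: eq_bigr => l _; case: forallP => [l_gt0|]; last first.
  (* A zero exponent selects the vanishing constant term of the shift; this is why only compositions
     into positive parts remain. *)
  move=> /forallP; rewrite negb_forall => /existsP[i].
  rewrite -eqn0Ngt => /eqP li0.
  by rewrite (bigD1 i) //= li0 poly_shift0 mul0r coef0.
rewrite coef_prod_ffun mulr_sumr; apply: eq_bigr => b _.
have -> : y ^+ k = \prod_(i < k) y by rewrite prodr_const card_ord.
rewrite -big_split /=; apply: eq_bigr => i _.
rewrite coef_poly_shift -(negbK (_ == 0%N)) -lt0n l_gt0 /= coef_poly.
have -> : (l i + b i < N)%N.
  by have := ltn_ord (l i); have := ltn_ord (b i); lia.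
rewrite /ps1 -(negbK (_ == 0%N)) -lt0n ltn_addr ?l_gt0 //= subr0 addnC.
have := natr_bin_fact R (l i) (b i); rewrite [(l i + b i)%N]addnC => ->.
rewrite -mulr_natr; field; rewrite !fact_neq0 pnatr_eq0 -lt0n bin_gt0.
by rewrite leq_addl.
Qed.

(** * Expectation of a product of independent random variables *)

Lemma Rintegral_sum (R : realType) (d : measure_display) (T : measurableType d)
    (mu : measure T R) (I : Type) (s : seq I) (p : pred I) (f : I -> T -> R) :
  (forall i, mu.-integrable setT (EFin \o f i)) ->
  mu.-integrable setT (EFin \o (fun w => \sum_(i <- s | p i) f i w)) /\
  \int[mu]_w (\sum_(i <- s | p i) f i w) = \sum_(i <- s | p i) \int[mu]_w f i w.
Proof.
move=> fi.
have E : EFin \o (fun w => \sum_(i <- s | p i) f i w) =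
    (fun w => \sum_(i <- s | p i) (EFin \o f i) w)%E.
  by apply/funext => w /=; rewrite sumEFin.
split; first by rewrite E; exact: integrable_sum.
rewrite /Rintegral -[X in fine (integral _ _ X)]/(EFin \o _) E integral_sum //.
by rewrite -sum_fine // => i _; exact: integrable_fin_num.
Qed.

(** The hypothesis is the factorization for indicators of X, with [c] in the role of the expectation
    of H. It extends by linearity, a simple function being a finite combination of indicators of its
    level sets. *)
Lemma Rintegral_nnsfun_comp (R : realType) (d : measure_display)
    (T : measurableType d) (P : probability T R) (H X : T -> R) (c : R)
    (f : {nnsfun R >-> R}) :
  P.-integrable setT (EFin \o H) -> measurable_fun setT X ->
  (forall A, measurable A ->
    \int[P]_w (H w * \1_A (X w)) = c * \int[P]_w (\1_A (X w))) ->
  P.-integrable setT (EFin \o (fun w => H w * f (X w))) /\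
  \int[P]_w (H w * f (X w)) = c * \int[P]_w f (X w).
Proof.
move=> iH mX HX.
have /measurable_EFinP mH := measurable_int P iH.
have mA y : measurable (f @^-1` [set y]) by exact: measurable_sfunP.
have iX y : P.-integrable setT (EFin \o (fun w => \1_(f @^-1` [set y]) (X w))).
  apply: (integrable_indic _ (A := X @^-1` (f @^-1` [set y]))).
  by rewrite -[X in measurable X]setTI; exact: mX.
have iHX y : P.-integrable setT
    (EFin \o (fun w => H w * \1_(f @^-1` [set y]) (X w))).
  apply: (le_integrable _ _ _ iH) => //.
    apply/measurable_EFinP/measurable_funM; first exact: mH.
    by have /measurable_EFinP := measurable_int P (iX y).
  move=> w _ /=; rewrite lee_fin normrM ler_piMr // indicE.
  by case: (_ \in _); rewrite ?normr1 ?normr0.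
pose s := finmap.enum_fset (fset_set (range f)).
have fE w : f (X w) = \sum_(y <- s) y * \1_(f @^-1` [set y]) (X w).
  by rewrite [LHS]fimfunE fsbig_finite //; exact: fimfunP.
have HfE w : H w * f (X w) = \sum_(y <- s) y * (H w * \1_(f @^-1` [set y]) (X w)).
  by rewrite fE mulr_sumr; apply: eq_bigr => y _; rewrite mulrCA.
rewrite (funext HfE) (funext fE).
have [|i1 ->] := @Rintegral_sum _ _ _ P _ s xpredT
    (fun y w => y * (H w * \1_(f @^-1` [set y]) (X w))).
  by move=> y; exact: (integrableZl measurableT y (iHX y)).
have [|_ ->] := @Rintegral_sum _ _ _ P _ s xpredT
    (fun y w => y * \1_(f @^-1` [set y]) (X w)).
  by move=> y; exact: (integrableZl measurableT y (iX y)).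
split => //; rewrite mulr_sumr; apply: eq_bigr => y _.
by rewrite !RintegralZl // HX // mulrCA.
Qed.

(** Approximate g from below by simple functions and pass to the limit on both sides by monotone
    convergence. *)
Lemma ge0_Rintegral_comp (R : realType) (d : measure_display)
    (T : measurableType d) (P : probability T R) (H X : T -> R) (c : R)
    (g : R -> R) :
  P.-integrable setT (EFin \o H) -> (forall w, 0 <= H w) ->
  measurable_fun setT X ->
  (forall A, measurable A ->
    \int[P]_w (H w * \1_A (X w)) = c * \int[P]_w (\1_A (X w))) ->
  measurable_fun setT g -> (forall r, 0 <= g r) ->
  P.-integrable setT (EFin \o (g \o X)) ->
  P.-integrable setT (EFin \o (fun w => H w * g (X w))) /\
  \int[P]_w (H w * g (X w)) = c * \int[P]_w g (X w).
Proof.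
move=> iH H0 mX HX mg g0 igX.
have mg' : measurable_fun setT (EFin \o g) by exact/measurable_EFinP.
pose f := nnsfun_approx measurableT mg'.
have /measurable_EFinP mH := measurable_int P iH.
have cvgf r : (f n r)%:E @[n --> \oo] --> (g r)%:E.
  by apply: (cvg_nnsfun_approx measurableT mg') => // x _; rewrite lee_fin.
have ndf r m n : (m <= n)%N -> f m r <= f n r.
  by move=> mn; have /lefP := nd_nnsfun_approx measurableT mg' mn; exact.
have mfX n : measurable_fun setT (fun w => f n (X w)) by exact: measurableT_comp.
have intf : (\int[P]_w (f n (X w))%:E)%E @[n --> \oo] --> (\int[P]_w (g (X w))%:E)%E.
  rewrite [X in _ --> X](_ : _ = (\int[P]_w limn (fun n => (f n (X w))%:E))%E); last first.
    by apply: eq_integral => w _; apply/esym/cvg_lim => //; exact: cvgf.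
  apply: cvg_monotone_convergence => //.
  - by move=> n; exact/measurable_EFinP.
  - by move=> n w _; rewrite lee_fin.
  - by move=> w _ m n mn; rewrite lee_fin ndf.
have intHf : (\int[P]_w (H w * f n (X w))%:E)%E @[n --> \oo] -->
    (\int[P]_w (H w * g (X w))%:E)%E.
  rewrite [X in _ --> X](_ : _ =
      (\int[P]_w limn (fun n => (H w * f n (X w))%:E))%E); last first.
    apply: eq_integral => w _; apply/esym/cvg_lim => //.
    rewrite EFinM; under eq_fun do rewrite EFinM.
    by apply: cvgeZl => //; exact: cvgf.
  apply: cvg_monotone_convergence => //.
  - by move=> n; exact/measurable_EFinP/measurable_funM.
  - by move=> n w _; rewrite lee_fin mulr_ge0.
  - by move=> w _ m n mn; rewrite lee_fin ler_wpM2l // ndf.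
have eqf n : (\int[P]_w (H w * f n (X w))%:E = c%:E * \int[P]_w (f n (X w))%:E)%E.
  have [iHf] := Rintegral_nnsfun_comp (f n) iH mX HX.
  have ifX : P.-integrable setT (EFin \o (fun w => f n (X w))).
    (* Integrability of the simple function of X comes from the previous lemma with H = 1 and c =
       1. *)
    have i1 : P.-integrable setT (EFin \o cst (1 : R)).
      exact: finite_measure_integrable_cst.
    have [|+ _] := @Rintegral_nnsfun_comp _ _ _ P (cst 1) X 1 (f n) i1 mX.
      move=> A mA; rewrite mul1r; congr Rintegral.
      by apply/funext => w; rewrite mul1r.
    by congr (integrable _ _ _); apply/funext => w /=; rewrite mul1r.
  move=> /(congr1 (@EFin R)); rewrite EFinM /Rintegral !fineK //.
  - exact: integrable_fin_num ifX.
  - exact: integrable_fin_num iHf.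
(* The limit is identified in the extended reals, since the left integral is not yet known to be
   finite. Its finiteness then follows from that of the right side. *)
have Heq : (\int[P]_w (H w * g (X w))%:E = c%:E * \int[P]_w (g (X w))%:E)%E.
  move: intHf; rewrite (funext eqf) => intHf.
  by apply: (cvg_unique _ intHf) => //; exact: cvgeZl.
split; last by rewrite /Rintegral Heq fineM // (integrable_fin_num _ igX).
apply/integrableP; split.
  by apply/measurable_EFinP/measurable_funM => //; exact: measurableT_comp.
rewrite (eq_integral (fun w => (H w * g (X w))%:E)); last first.
  by move=> w _ /=; rewrite ger0_norm // mulr_ge0.
by rewrite Heq ltey_eq fin_numM // (integrable_fin_num _ igX).
Qed.

(** Integrability is bundled with the product formula because the inductions below need both at each
    stage. *)
Definition Rintegral_prod_eq (R : realType) (d : measure_display)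
    (T : measurableType d) (P : probability T R) (k : nat) (X : 'I_k -> T -> R)
    (g : 'I_k -> R -> R) : Prop :=
  P.-integrable setT (EFin \o (fun w => \prod_(i < k) g i (X i w))) /\
  \int[P]_w (\prod_(i < k) g i (X i w)) = \prod_(i < k) \int[P]_w g i (X i w).

Section independent.
Variables (R : realType) (d : measure_display) (T : measurableType d).
Variables (P : probability T R) (k : nat) (X : 'I_k -> T -> R).
Hypothesis mX : forall i, measurable_fun setT (X i).
Hypothesis indep : forall A : 'I_k -> set R, (forall i, measurable (A i)) ->
  P (\bigcap_i (X i @^-1` A i)) = (\prod_(i < k) P (X i @^-1` A i))%E.

Let upd (g : 'I_k -> R -> R) (j : 'I_k) (h : R -> R) (i : 'I_k) : R -> R :=
  if i == j then h else g i.

Let mpre (i : 'I_k) (A : set R) : measurable A -> measurable (X i @^-1` A).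
Proof. by move=> mA; rewrite -[X in measurable X]setTI; exact: mX. Qed.

Let prod_upd (g : 'I_k -> R -> R) (j : 'I_k) (h : R -> R) (w : T) :
  \prod_(i < k) upd g j h i (X i w) =
  h (X j w) * \prod_(i < k | i != j) g i (X i w).
Proof.
rewrite (bigD1 j) //= /upd eqxx; congr (_ * _).
by apply: eq_bigr => i /negbTE ->.
Qed.

Let prod_int_upd (g : 'I_k -> R -> R) (j : 'I_k) (h : R -> R) :
  \prod_(i < k) \int[P]_w upd g j h i (X i w) =
  \int[P]_w h (X j w) * \prod_(i < k | i != j) \int[P]_w g i (X i w).
Proof.
rewrite (bigD1 j) //= /upd eqxx; congr (_ * _).
by apply: eq_bigr => i /negbTE ->.
Qed.

Let upd_id (g : 'I_k -> R -> R) (j : 'I_k) : upd g j (g j) = g.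
Proof. by apply/funext => i; rewrite /upd; case: eqP => [->|]. Qed.

Let integrable_indicX (i : 'I_k) (A : set R) : measurable A ->
  P.-integrable setT (EFin \o (fun w => \1_A (X i w))).
Proof.
by move=> mA; apply: (integrable_indic _ (A := X i @^-1` A)); exact: mpre.
Qed.

(** The product of the indicators is the indicator of the intersection, so this is the independence
    hypothesis itself. *)
Lemma Rintegral_prod_indic (A : 'I_k -> set R) :
  (forall i, measurable (A i)) -> Rintegral_prod_eq P X (fun i => \1_(A i)).
Proof.
move=> mA.
have E : (fun w => \prod_(i < k) \1_(A i) (X i w)) =
    \1_(\bigcap_i (X i @^-1` A i)) :> (T -> R).
  apply/funext => w; rewrite indicE; case: (boolP (_ \in _)) => [|/negP].
    rewrite inE => Aw; rewrite big1 // => i _.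
    by rewrite indicE mem_set //; exact: Aw.
  rewrite inE /= => /existsNP[i /not_implyP[_ Ai]].
  by rewrite (bigD1 i) //= indicE memNset // mul0r.
have mI : measurable (\bigcap_i (X i @^-1` A i)).
  by apply: fin_bigcap_measurable => // i _; exact: mpre.
split; rewrite E; first exact: integrable_indic.
transitivity (fine (P (\bigcap_i (X i @^-1` A i)))).
  by rewrite /Rintegral integral_indic // setIT.
rewrite indep //.
apply/EFin_inj; rewrite -prodEFin fineK; last first.
  by rewrite -indep // fin_num_measure.
apply: eq_bigr => i _; rewrite fineK.
  have := integral_indic P measurableT (@mpre i _ (mA i)).
  by rewrite setIT => <-.
exact: integrable_fin_num (@integrable_indicX i _ (mA i)).
Qed.

(* Induction on the number of coordinates at which an indicator has been
   replaced by a nonnegative function. *)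
Lemma ge0_Rintegral_prod (g : 'I_k -> R -> R) :
  (forall i, measurable_fun setT (g i)) -> (forall i r, 0 <= g i r) ->
  (forall i, P.-integrable setT (EFin \o (g i \o X i))) ->
  Rintegral_prod_eq P X g.
Proof.
suff main (j : nat) : forall g : 'I_k -> R -> R,
    (forall i, measurable_fun setT (g i)) -> (forall i r, 0 <= g i r) ->
    (forall i, P.-integrable setT (EFin \o (g i \o X i))) ->
    (forall i : 'I_k, (j <= i)%N -> exists2 A, measurable A & g i = \1_A) ->
    Rintegral_prod_eq P X g.
  move=> mg g0 ig; apply: (main k) => // i.
  by rewrite leqNgt ltn_ord.
elim: j => [|j IH] {}g mg g0 ig gA.
  have /choice[A /all_and2[mA gE]] i : exists A, measurable A /\ g i = \1_A.
    by have [//|A] := gA i; exists A.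
  have -> : g = fun i => \1_(A i) by apply/funext.
  exact: Rintegral_prod_indic.
have [kj|jk] := leqP k j.
  apply: IH => // i ji; have := leq_trans kj ji.
  by rewrite leqNgt ltn_ord.
pose i0 := Ordinal jk.
have IHA A : measurable A -> Rintegral_prod_eq P X (upd g i0 (\1_A)).
  move=> mA; apply: IH => [i|i r|i|i ji]; rewrite /upd; case: eqP => [_|ii0] //.
  - exact: integrable_indicX.
  - by exists A.
  - apply: gA; rewrite ltn_neqAle ji andbT; apply/eqP => ij.
    by apply: ii0; apply/val_inj.
pose H w := \prod_(i < k | i != i0) g i (X i w).
pose c := \prod_(i < k | i != i0) \int[P]_w g i (X i w).
have HE A w : \prod_(i < k) upd g i0 (\1_A) i (X i w) = H w * \1_A (X i0 w).
  by rewrite prod_upd mulrC.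
(* Putting the indicator of the whole space at [i0] turns the induction hypothesis into
   integrability of the product of the other factors. *)
have iH : P.-integrable setT (EFin \o H).
  have [+ _] := IHA _ measurableT; rewrite (funext (HE _)).
  by congr (integrable _ _ _); apply/funext => w /=; rewrite indicT mulr1.
have [] := @ge0_Rintegral_comp _ _ _ P H (X i0) c (g i0) iH.
- by move=> w; rewrite prodr_ge0.
- exact: mX.
- move=> A mA; have [_] := IHA _ mA.
  by rewrite (funext (HE _)) prod_int_upd mulrC.
- exact: mg.
- exact: g0.
- exact: ig.
have gE w : H w * g i0 (X i0 w) = \prod_(i < k) g i (X i w).
  by rewrite -[in RHS](upd_id g i0) prod_upd mulrC.
rewrite (funext gE) => i1 e1; split => //.
by rewrite -[in RHS](upd_id g i0) prod_int_upd mulrC.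
Qed.

(* Positive and negative parts, one coordinate at a time. *)
Lemma Rintegral_prod (g : 'I_k -> R -> R) :
  (forall i, measurable_fun setT (g i)) ->
  (forall i, P.-integrable setT (EFin \o (g i \o X i))) ->
  Rintegral_prod_eq P X g.
Proof.
(* Only the coordinates below [j] may change sign; [j = 0] is the nonnegative case and [j = k] the
   claim. *)
suff main (j : nat) : forall g : 'I_k -> R -> R,
    (forall i, measurable_fun setT (g i)) ->
    (forall i, P.-integrable setT (EFin \o (g i \o X i))) ->
    (forall i : 'I_k, (j <= i)%N -> forall r, 0 <= g i r) ->
    Rintegral_prod_eq P X g.
  move=> mg ig; apply: (main k) => // i.
  by rewrite leqNgt ltn_ord.
elim: j => [|j IH] {}g mg ig g0.
  by apply: ge0_Rintegral_prod => // i; exact: g0.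
have [kj|jk] := leqP k j.
  apply: IH => // i ji; have := leq_trans kj ji.
  by rewrite leqNgt ltn_ord.
pose i0 := Ordinal jk.
have IHu (h : R -> R) : measurable_fun setT h -> (forall r, 0 <= h r) ->
    P.-integrable setT (EFin \o (h \o X i0)) -> 
    Rintegral_prod_eq P X (upd g i0 h).
  move=> mh h0 ih; apply: IH => [i|i|i ji]; rewrite /upd;
    case: eqP => [ei|ii0] //.
    by rewrite ei.
  apply: g0; rewrite ltn_neqAle ji andbT; apply/eqP => ij.
  by apply: ii0; apply/val_inj.
have [||ip ep] := IHu (g i0)^\+ _ (funrpos_ge0 _).
- exact: measurable_funrpos.
- exact: (integrable_funrpos measurableT (ig i0)).
have [||im em] := IHu (g i0)^\- _ (funrneg_ge0 _).
- exact: measurable_funrneg.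
- exact: (integrable_funrneg measurableT (ig i0)).
have gE w : \prod_(i < k) upd g i0 (g i0)^\+ i (X i w) -
    \prod_(i < k) upd g i0 (g i0)^\- i (X i w) = \prod_(i < k) g i (X i w).
  rewrite !prod_upd -mulrBl -[in RHS](upd_id g i0) prod_upd.
  by congr (_ * _); rewrite -{3}(funrposBneg (g i0)).
have -> : g = upd g i0 (g i0) by rewrite upd_id.
split.
  have := integrableB measurableT ip im.
  congr (integrable _ _ _); apply/funext => w /=.
  by rewrite upd_id -gE EFinB.
rewrite prod_int_upd upd_id -(funext gE) RintegralB // ep em !prod_int_upd.
rewrite -mulrBl -RintegralB //.
- by rewrite -{3}(funrposBneg (g i0)).
- exact: (integrable_funrpos measurableT (ig i0)).
- exact: (integrable_funrneg measurableT (ig i0)).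
Qed.
End independent.

(** * Moments *)

Lemma integrable_mgf_exp (R : realType) (d : measure_display)
    (T : measurableType d) (P : probability T R) (Y : {RV P >-> R}) (t : R) :
  ('M_P Y t \is a fin_num)%E ->
  P.-integrable setT (EFin \o (fun w => expR (t * Y w))).
Proof.
move=> Mt; apply/integrableP; split.
  by apply/measurable_EFinP; apply: measurableT_comp => //; exact: measurable_funM.
move: Mt; rewrite /mmt_gen_fun unlock => Mt.
rewrite (eq_integral (fun w => (expR (t * Y w))%:E)); last first.
  by move=> w _ /=; rewrite ger0_norm // expR_ge0.
rewrite ltey_eq; apply/orP; left; move: Mt; congr (is_true (_ \is a fin_num)).
by apply: eq_integral => w _ /=; rewrite mulrC.
Qed.

(** A single term of the exponential series is at most its sum. *)
Lemma exprn_le_expR (R : realType) (x : R) (n : nat) :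
  0 <= x -> x ^+ n <= n`!%:R * expR x.
Proof.
move=> x0; rewrite mulrC -ler_pdivrMr ?ltr0n ?fact_gt0 //.
case: n => [|n]; first by rewrite expr0 fact0 divr1 -expR0 ler_expR.
by apply: le_trans (expR_ge1Dxn n x0); rewrite lerDr.
Qed.

Lemma integrable_moment (R : realType) (d : measure_display)
    (T : measurableType d) (P : probability T R) (Y : {RV P >-> R}) (r : R) :
  0 < r -> (forall t, `|t| < r -> ('M_P Y t \is a fin_num)%E) ->
  forall n : nat, P.-integrable setT (EFin \o (fun w => Y w ^+ n)).
Proof.
(* Both s and -s lie inside the interval of convergence, and |Y|^n is dominated by n! / s^n times
   exp(s Y) + exp(-s Y). *)
move=> r0 MY n; pose s := r / 2.
have s0 : 0 < s by rewrite divr_gt0.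
have sr : s < r by rewrite /s; lra.
have ip : P.-integrable setT (EFin \o (fun w => expR (s * Y w))).
  by apply/integrable_mgf_exp/MY; rewrite gtr0_norm.
have im : P.-integrable setT (EFin \o (fun w => expR (- s * Y w))).
  by apply/integrable_mgf_exp/MY; rewrite normrN gtr0_norm.
have := integrableZl measurableT (n`!%:R / s ^+ n) (integrableD measurableT ip im).
apply: le_integrable => //.
  by apply/measurable_EFinP; exact: measurable_funX.
move=> w _ /=; rewrite lee_fin.
have sn0 : 0 < s ^+ n by rewrite exprn_gt0.
have E0 : 0 <= expR (s * Y w) + expR (- s * Y w) by rewrite addr_ge0 // expR_ge0.
rewrite [leRHS]ger0_norm; last by rewrite mulr_ge0 // divr_ge0 // ltW.
rewrite normrX mulrAC ler_pdivlMr //.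
have -> : `|Y w| ^+ n * s ^+ n = `|s * Y w| ^+ n.
  by rewrite -exprMn normrM (gtr0_norm s0) mulrC.
apply: le_trans (exprn_le_expR n (normr_ge0 _)) _.
rewrite ler_wpM2l //; case: ger0P => _; first by rewrite lerDl expR_ge0.
by rewrite -mulNr lerDr expR_ge0.
Qed.

(** * Transfer of moments to independent copies *)

Lemma same_law_ge0_integral (R : realType) (d : measure_display)
    (T : measurableType d) (P : probability T R) (d' : measure_display)
    (U : measurableType d') (Q : probability U R) (X : {RV P >-> R})
    (Y : {RV Q >-> R}) (h : R -> \bar R) :
  same_law P X Q Y -> measurable_fun setT h -> (forall r, 0 <= h r)%E ->
  (\int[P]_w h (X w) = \int[Q]_w h (Y w))%E.
Proof.
move=> XY mh h0.
rewrite -(ge0_integral_distribution X mh h0) -(ge0_integral_distribution Y mh h0).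
by apply: eq_measure_integral => A mA _; exact: XY.
Qed.

Lemma same_law_integral (R : realType) (d : measure_display)
    (T : measurableType d) (P : probability T R) (d' : measure_display)
    (U : measurableType d') (Q : probability U R) (X : {RV P >-> R})
    (Y : {RV Q >-> R}) (h : R -> R) :
  same_law P X Q Y -> measurable_fun setT h ->
  Q.-integrable setT (EFin \o (h \o Y)) ->
  P.-integrable setT (EFin \o (h \o X)) /\
  \int[P]_w h (X w) = \int[Q]_w h (Y w).
Proof.
move=> XY mh ihY.
have mh' : measurable_fun setT (EFin \o h) by exact/measurable_EFinP.
have ihX : P.-integrable setT (EFin \o (h \o X)).
  apply/integrableP; split.
    by apply/measurable_EFinP; apply: (measurableT_comp mh).
  (* The nonnegative case applied to |h| transfers integrability from Y to X. *)
  have habs : measurable_fun setT (abse \o (EFin \o h)) by exact: measurableT_comp.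
  have := same_law_ge0_integral XY habs (fun r => abse_ge0 _).
  by rewrite /= => ->; case/integrableP : ihY.
split => //; congr fine.
rewrite -[LHS](integral_distribution mh' ihX) -[RHS](integral_distribution mh' ihY).
by apply: eq_measure_integral => A mA _; exact: XY.
Qed.

Lemma mutually_independent_ord (R : realType) (d : measure_display)
    (T : measurableType d) (P : probability T R) (X : nat -> T -> R) (k : nat)
    (A : 'I_k -> set R) :
  mutually_independent P X -> (forall i, measurable (A i)) ->
  P (\bigcap_(i in [set: 'I_k]) (X i @^-1` A i)) =
  (\prod_(i < k) P (X i @^-1` A i))%E.
Proof.
move=> indX mA.
(* The sets are extended to all indices by the whole line; only the indices below k are then
   used. *)
pose B (i : nat) : set R :=
  if (insub i : option 'I_k) is Some j then A j else setT.
have BE (i : 'I_k) : B i = A i by rewrite /B valK.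
have mB i : measurable (B i) by rewrite /B; case: insub.
have := indX (index_iota 0 k) B (iota_uniq _ _) mB.
rewrite !big_mkord => H.
under [RHS]eq_bigr do rewrite -BE.
rewrite -H -bigcap_seq; congr (P _).
apply/seteqP; split => w /= Aw i _; rewrite ?BE; [|rewrite -BE].
  all: by apply: Aw => //=; rewrite mem_index_enum.
Qed.

Section iid_moments.
Variables (R : realType) (d' : measure_display) (U : measurableType d').
Variables (Q : probability U R) (Y : {RV Q >-> R}).
Variables (d : measure_display) (T : measurableType d) (P : probability T R).
Variable Ys : nat -> {RV P >-> R}.
Hypothesis intY : forall n, Q.-integrable setT (EFin \o (fun w => Y w ^+ n)).
Hypothesis indYs : mutually_independent P (fun j => (Ys j : T -> R)).
Hypothesis lawYs : forall j, same_law P (Ys j) Q Y.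

Lemma Rintegral_prod_moments (k : nat) (b : 'I_k -> nat) :
  P.-integrable setT (EFin \o (fun w => \prod_(i < k) Ys i w ^+ b i)) /\
  \int[P]_w (\prod_(i < k) Ys i w ^+ b i) =
  \prod_(i < k) \int[Q]_w (Y w ^+ b i).
Proof.
have mX (n : nat) : measurable_fun setT (fun r : R => r ^+ n) by exact: measurable_funX.
have sl (i : 'I_k) := same_law_integral (lawYs i) (mX (b i)) (intY (b i)).
have [||||i1 e1] := @Rintegral_prod _ _ _ P k
  (fun i => (Ys i : T -> R)) _ _ (fun i r => r ^+ b i).
- by move=> i.
- by move=> A; exact: (mutually_independent_ord (X := fun j => (Ys j : T -> R))).
- by move=> i; exact: mX.
- by move=> i; have [] := sl i.
by split => //; rewrite e1; apply: eq_bigr => i _; have [] := sl i.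
Qed.

(** Expand the power of the sum by the multinomial theorem; each resulting monomial in the copies
    factors by independence. *)
Lemma Ereal_Ssum_prod (k p : nat) (l : 'I_k -> nat) :
  Ereal P (fun w => Ssum (fun i => (Ys i : T -> R)) k w ^+ p *
                    \prod_(i < k) Ys i w ^+ l i) =
  \sum_(b : {ffun 'I_k -> 'I_p.+1} | (\sum_(i < k) b i)%N == p)
    p`!%:R * \prod_(i < k) (Ereal Q (fun w => Y w ^+ (b i + l i)) / (b i)`!%:R).
Proof.
pose F (b : {ffun 'I_k -> 'I_p.+1}) w :=
  p`!%:R / (\prod_(i < k) (b i)`!%:R) * \prod_(i < k) Ys i w ^+ (b i + l i).
have FE w : Ssum (fun i => (Ys i : T -> R)) k w ^+ p * \prod_(i < k) Ys i w ^+ l i =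
    \sum_(b : {ffun 'I_k -> 'I_p.+1} | (\sum_(i < k) b i)%N == p) F b w.
  rewrite /Ssum sum_exp_multinomial mulr_suml; apply: eq_bigr => b _.
  rewrite /F -mulrA -[RHS]mulrA; congr (_ * _).
  rewrite -prodfV -!big_split /=; apply: eq_bigr => i _.
  by rewrite exprD; ring.
rewrite (funext FE) -[LHS]/(\int[P]_w (\sum_(b : {ffun 'I_k -> 'I_p.+1} |
  (\sum_(i < k) b i)%N == p) F b w)).
have iF b : P.-integrable setT (EFin \o F b).
  exact: (integrableZl measurableT _ (Rintegral_prod_moments _).1).
have [_ ->] := @Rintegral_sum _ _ _ P _ (index_enum _)
  (fun b : {ffun 'I_k -> 'I_p.+1} => (\sum_(i < k) b i)%N == p) F iF.
apply: eq_bigr => b _.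
have [ib eb] := Rintegral_prod_moments (fun i => (b i + l i)%N).
rewrite /F RintegralZl // eb -mulrA; congr (_ * _).
by rewrite -prodfV -big_split; apply: eq_bigr => i _; rewrite mulrC.
Qed.

(** Coefficient form of V(t, s)^k = y^k E[exp(t S_k) prod_i (exp(s Y_i) - 1)]; the factorials n! p!
    pass from ordinary to exponential coefficients. *)
Lemma comp_sum_coef (y : R) (N n k p : nat) : (n + p < N)%N ->
  y ^+ k * comp_sum P (fun i => (Ys i : T -> R)) n k p =
  n`!%:R * p`!%:R *
  (poly_shift (\poly_(j < N) (y * (mgf_ps Q Y j - ps1 R j))) ^+ k)`_n`_p.
Proof.
move=> npN; rewrite (coef_poly_shift_exp (fun j => Ereal Q (fun w => Y w ^+ j))) //.
rewrite /comp_sum mulrCA; congr (_ * _); rewrite mulr_sumr.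
apply: eq_bigr => l _; rewrite Ereal_Ssum_prod /multinom !mulr_sumr.
apply: eq_bigr => b _; rewrite -prodfV mulrACA; congr (_ * _).
rewrite -big_split; apply: eq_bigr => i _ /=.
by rewrite invfM; ring.
Qed.
End iid_moments.

Theorem theorem2p2 (R : realType)
  (d' : measure_display) (U : measurableType d') (Q : probability U R)
  (Y : {RV Q >-> R})
  (d : measure_display) (T : measurableType d) (P : probability T R)
  (Ys : nat -> {RV P >-> R}) (r0 : R) :
  0 < r0 ->
  (forall t : R, `|t| < r0 -> ('M_Q Y t \is a fin_num)%E) ->
  mutually_independent P (fun j => (Ys j : T -> R)) ->
  (forall j, same_law P (Ys j) Q Y) ->
  forall (m n : nat) (x y : R),
    phiY Q Y (m + n) x y =
    \sum_(k < n.+1) \sum_(j < m.+1)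
       'C(m, j)%:R * phiY Q Y j (x - k%:R) y * falling x k * y ^+ k
       * (k`!%:R)^-1 * comp_sum P (fun i => (Ys i : T -> R)) n k (m - j).
Proof.
move=> r0_gt0 MY indYs lawYs m n x y.
have intY := integrable_moment r0_gt0 MY.
pose u j := y * (mgf_ps Q Y j - ps1 R j).
(* The zeroth moment is 1 because [Q] has total mass 1. *)
have u0 : u 0%N = 0.
  rewrite /u /mgf_ps /ps1 /Ereal (eq_integral (cst 1%:E)) => [|w _];
    last by rewrite expr0.
  rewrite integral_cst // mul1e -[X in fine X]/(Q setT) probability_setT.
  by rewrite fact0 divr1 subrr mulr0.
pose p := \poly_(j < (m + n).+1) u j.
have p0 : p`_0 = 0 by rewrite coef_poly u0.
have phiE (z : R) j : (j < (m + n).+1)%N ->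
    phiY Q Y j z y = j`!%:R * (binsum polyC (m + n).+1 z p)`_j.
  by move=> jmn; rewrite /phiY (psbinom_poly _ u0 jmn).
(* Writing (m + n)! = C(m + n, n) n! m! supplies the binomial factor on the left of
   [coef_binsumD]. *)
have := natr_bin_fact R n m; rewrite [(n + m)%N]addnC => fact_mn.
rewrite phiE // fact_mn.
rewrite (mulrC 'C(_, _)%:R) -mulrA (mulrC 'C(_, _)%:R).
rewrite coef_binsumD // mulr_sumr; apply: eq_bigr => k _.
rewrite mulr_sumr; apply: eq_bigr => j _.
have jm : (j <= m)%N by rewrite -ltnS.
rewrite phiE; last by lia.
have -> : 'C(m, j)%:R * (j`!%:R * (binsum polyC (m + n).+1 (x - k%:R) p)`_j) *
    falling x k * y ^+ k / k`!%:R * comp_sum P (fun i => (Ys i : T -> R)) n k (m - j) =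
    'C(m, j)%:R * (j`!%:R * (binsum polyC (m + n).+1 (x - k%:R) p)`_j) *
    binr x k * (y ^+ k * comp_sum P (fun i => (Ys i : T -> R)) n k (m - j)).
  by rewrite /binr; ring.
rewrite (comp_sum_coef intY indYs lawYs _ (N := (m + n).+1)); last by lia.
(* Here m! = C(m, j) j! (m - j)! accounts for the remaining binomial and factorials. *)
have := natr_bin_fact R j (m - j); rewrite subnKC // => ->.
rewrite -/p; ring.
Qed.
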